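(* Let $\check u^{(1)}$ and $\check u^{(2)}$ be Geronimus transformations of the bivariate linear functional $u$ associated with $L^{(a)}(z)=L^{(a)}_nz^n+\dots+L^{(a)}_{-m}z^{-m}$, $a=1,2$, where the Gram matrices $G,\check G^{(1)},\check G^{(2)}$ are quasidefinite. Put $\underline n=\max(n,m)$, $\Omega^{(1)}_2=\check S^{(1)}_2S_2^{-1}$, $\Omega^{(2)}_1=\check S^{(2)}_1S_1^{-1}$. Then for $l\ge2\underline n$ $$\check K^{(1),[l]}(\bar z_1,z_2)-L^{(1)}(z_2)K^{[l]}(\bar z_1,z_2)=-\big[\check\phi^{(1)}_{1,l}(z_2),\dots,\check\phi^{(1)}_{1,l+2\underline n-1}(z_2)\big](\check H^{(1)}[\underline n,l])^{-1}\,\overline{\Omega^{(1)}_2[\underline n,l]}\begin{bmatrix}\overline{\phi_{2,l-2\underline n}(z_1)}\\ \vdots\\ \overline{\phi_{2,l-1}(z_1)}\end{bmatrix},$$ $$\check K^{(2),[l]}(\bar z_1,z_2)-\overline{L^{(2)}}(\bar z_1)K^{[l]}(\bar z_1,z_2)=-\big[\overline{\check\phi^{(2)}_{2,l}(z_1)},\dots,\overline{\check\phi^{(2)}_{2,l+2\underline n-1}(z_1)}\big](\check H^{(2)}[\underline n,l])^{-1}\,\Omega^{(2)}_1[\underline n,l]\begin{bmatrix}\phi_{1,l-2\underline n}(z_2)\\ \vdots\\ \phi_{1,l-1}(z_2)\end{bmatrix}.$$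
   Context: Indices start at $0$; $\mathbb C^*=\mathbb C\setminus\{0\}$; $\overline L(z):=\overline{L(\bar z)}$, so $\overline{L}(\bar z)=\overline{L(z)}$; a bar over a matrix is entrywise conjugation. CMV sequence: $\chi(z)=[1,z^{-1},z,z^{-2},z^2,\dots]^\top$. A bivariate linear functional $v=v_{z_1,\bar z_2}$ is a continuous linear functional with well-defined closed support in $\mathbb C^*\times\mathbb C^*$ on a space of test functions (e.g. a compactly supported distribution) containing all $f(z_1)\otimes\overline{g(z_2)}:=f(z_1)\overline{g(z_2)}$ with $f,g$ Laurent polynomials or, more generally, rational functions with nonzero poles outside $\operatorname{supp}_1(v)$, resp. $\operatorname{supp}_2(v)$, the projections of the support on the $z_1$-, resp. $z_2$-coordinate; $\langle f,g\rangle_v=\langle v,f(z_1)\otimes\overline{g(z_2)}\rangle$. The Gram matrix of $v$ has entries $\langle\chi^{(k)},\chi^{(l)}\rangle_v$; quasidefinite means that all leading principal minors are nonzero. Then $G=S_1^{-1}H(S_2^{-1})^\dagger$ (Gram matrix of $u$) uniquely, with $S_1,S_2$ lower unitriangular and $H=\operatorname{diag}(H_0,H_1,\dots)$ with nonzero entries; $\phi_a=S_a\chi=[\phi_{a,0},\phi_{a,1},\dots]^\top$; $K^{[l]}(\bar z_1,z_2)=\sum_{k=0}^{l-1}\overline{\phi_{2,k}(z_1)}H_k^{-1}\phi_{1,k}(z_2)$. $L^{(a)}_nL^{(a)}_{-m}\ne0$, $n,m\in\{0,1,\dots\}$, and the zero sets $\sigma(L^{(a)})\subset\mathbb C^*$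 satisfy $\sigma(L^{(1)})\cap\operatorname{supp}_1(u)=\varnothing$, $\sigma(L^{(2)})\cap\operatorname{supp}_2(u)=\varnothing$. Geronimus transformations are bivariate functionals with $L^{(1)}(z_1)\check u^{(1)}=u$ and $\check u^{(2)}\overline{L^{(2)}(z_2)}=u$, i.e. $\langle L^{(1)}f,g\rangle_{\check u^{(1)}}=\langle f,g\rangle_u$ and $\langle f,L^{(2)}g\rangle_{\check u^{(2)}}=\langle f,g\rangle_u$. Objects $\check S^{(a)}_b,\check H^{(a)}_k,\check\phi^{(a)}_{b,k},\check K^{(a),[l]}$ are those associated in the same way with $\check u^{(a)}$. $\Omega^{(1)}_2[\underline n,l]$ and $\Omega^{(2)}_1[\underline n,l]$ are the $2\underline n\times2\underline n$ (upper triangular) submatrices of $\Omega^{(1)}_2$, resp. $\Omega^{(2)}_1$, with rows $l,\dots,l+2\underline n-1$ and columns $l-2\underline n,\dots,l-1$; $\check H^{(a)}[\underline n,l]=\operatorname{diag}(\check H^{(a)}_l,\dots,\check H^{(a)}_{l+2\underline n-1})$. *)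

(* Defs.v *)
(* Library world: MathComp with MathComp-Analysis; the complex numbers are
   R[i] for R : realType. *)
From HB Require Import structures.
From mathcomp Require Import all_boot all_order all_algebra.
From mathcomp Require Import all_classical all_reals all_analysis.
From mathcomp Require Export complex.

Set Implicit Arguments.
Unset Strict Implicit.
Unset Printing Implicit Defensive.

Import Order.TTheory GRing.Theory Num.Theory.
Import numFieldNormedType.Exports.
Local Open Scope classical_set_scope.
Local Open Scope ring_scope.

Section BivariateFunctionals.
Variable C : numClosedFieldType.

(* Functions of a variable in C \ {0} are represented by total functions on C
   whose value at 0 is irrelevant. *)
Definition Cstar2 : set (C * C) := [set p | p.1 != 0 /\ p.2 != 0].

Definition closed_Cstar2 (S : set (C * C)) : Prop :=
  S `<=` Cstar2 /\ closure S `&` Cstar2 `<=` S.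

(* f is a rational function all of whose nonzero poles are outside A (in
   particular any Laurent polynomial).  At a nonzero zero of q, which is not
   in A, the value of f is the conventional 0. *)
Definition rational_off (A : set C) (f : C -> C) : Prop :=
  exists p q : {poly C}, [/\ q != 0,
    forall z, z != 0 -> A z -> q.[z] != 0 &
    forall z, z != 0 -> f z = p.[z] / q.[z]].

Definition is_tensor (f g : C -> C) (h : C * C -> C) : Prop :=
  forall z1 z2, z1 != 0 -> z2 != 0 -> h (z1, z2) = f z1 * (g z2)^*.

Section Support.
Variables (E : topologicalLmodType C) (ev : E -> C * C -> C)
  (v : {linear E -> C^o}).

Definition vanishes_off (S : set (C * C)) : Prop :=
  forall t : E,
    closure [set p | Cstar2 p /\ ev t p != 0] `&` S = set0 -> v t = 0.

(* The support is the least closed subset of (C \ {0})^2 outside of which the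
   functional vanishes. *)
Definition is_support (S : set (C * C)) : Prop :=
  [/\ closed_Cstar2 S, vanishes_off S &
      forall S', closed_Cstar2 S' -> vanishes_off S' -> S `<=` S'].
End Support.

(* A continuous linear functional on a topological vector space of functions
   on (C \ {0})^2; tf_ev sends a test function to its values. *)
Record bifunctional := Bifunctional {
  testfun : topologicalLmodType C ;
  tf_ev : testfun -> C * C -> C ;
  pairing : {linear testfun -> C^o} ;
  supp : set (C * C) ;
  tf_ev_linear : forall a s t p, Cstar2 p ->
    tf_ev (a *: s + t) p = a * tf_ev s p + tf_ev t p ;
  tf_ev_inj : forall s t,
    (forall p, Cstar2 p -> tf_ev s p = tf_ev t p) -> s = t ;
  pairing_continuous : continuous (pairing : testfun -> C) ;
  supp_is_support : is_support tf_ev pairing supp ;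
  tf_tensor : forall f g,
    rational_off [set p.1 | p in supp] f ->
    rational_off [set p.2 | p in supp] g ->
    exists t, is_tensor f g (tf_ev t) }.

Definition supp1 (v : bifunctional) : set C := [set p.1 | p in supp v].
Definition supp2 (v : bifunctional) : set C := [set p.2 | p in supp v].

(* <f, g>_v = <v, f(z1) (x) conj (g(z2))>; by tf_ev_inj there is at most one
   test function equal to this tensor product. *)
Definition bracket (v : bifunctional) (f g : C -> C) : C :=
  pairing v (xget 0 [set t | is_tensor f g (tf_ev t)]).

Definition chi (k : nat) (z : C) : C :=
  if odd k then z ^- uphalf k else z ^+ k./2.

Definition gram (v : bifunctional) (k l : nat) : C :=
  bracket v (chi k) (chi l).

Definition trunc (N : nat) (A : nat -> nat -> C) : 'M[C]_N :=
  \matrix_(i < N, j < N) A i j.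

Definition quasidefinite (v : bifunctional) : Prop :=
  forall N, \det (trunc N (gram v)) != 0.

(* Semi-infinite matrices are functions nat -> nat -> C. *)
Definition lower_unitriangular (S : nat -> nat -> C) : Prop :=
  (forall i, S i i = 1) /\ (forall i j, (i < j)%N -> S i j = 0).

(* Inverse of a lower unitriangular semi-infinite matrix: its truncations are
   the inverses of the truncations. *)
Definition linv (S : nat -> nat -> C) (i j : nat) : C :=
  invmx (trunc (maxn i j).+1 S) (inord i) (inord j).

(* Product A B of semi-infinite matrices for A lower triangular. *)
Definition lmul (A B : nat -> nat -> C) (i j : nat) : C :=
  \sum_(k < i.+1) A i k * B k j.

(* G = S1^-1 H (S2^-1)^dagger; the entries of S1^-1 and S2^-1 above the
   diagonal are zero. *)
Definition gauss_borel (G S1 : nat -> nat -> C) (H : nat -> C)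
    (S2 : nat -> nat -> C) : Prop :=
  [/\ lower_unitriangular S1, lower_unitriangular S2,
      forall k, H k != 0 &
      forall i j, G i j =
        \sum_(k < (minn i j).+1) linv S1 i k * H k * (linv S2 j k)^*].

(* The Gauss-Borel factors (S1, H, S2) of the Gram matrix; they exist and are
   unique when v is quasidefinite. *)
Definition gb_factors (v : bifunctional) :
    (nat -> nat -> C) * (nat -> C) * (nat -> nat -> C) :=
  xget (fun _ _ => 0, fun _ => 0, fun _ _ => 0)
    [set T | gauss_borel (gram v) T.1.1 T.1.2 T.2].

Definition S1_of (v : bifunctional) := (gb_factors v).1.1.
Definition H_of (v : bifunctional) := (gb_factors v).1.2.
Definition S2_of (v : bifunctional) := (gb_factors v).2.

Definition phi1 (v : bifunctional) (k : nat) (z : C) : C :=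
  \sum_(j < k.+1) S1_of v k j * chi j z.
Definition phi2 (v : bifunctional) (k : nat) (z : C) : C :=
  \sum_(j < k.+1) S2_of v k j * chi j z.

Definition conjfun (f : C -> C) (z : C) : C := (f z^*)^*.

(* CD_kernel v l w z = K^[l](w, z); with w = z1^* its terms are
   (phi2 v k z1)^* / H_k * phi1 v k z. *)
Definition CD_kernel (v : bifunctional) (l : nat) (w z : C) : C :=
  \sum_(k < l) conjfun (phi2 v k) w * (H_of v k)^-1 * phi1 v k z.

(* L i is the coefficient of z^i, for -m <= i <= n. *)
Definition laurent (n m : nat) (L : int -> C) (z : C) : C :=
  \sum_(j < (n + m).+1) L (j%:Z - m%:Z) * z ^ (j%:Z - m%:Z).

Definition zeros (f : C -> C) : set C := [set z | z != 0 /\ f z = 0].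

Definition geronimus1 (L : C -> C) (u w : bifunctional) : Prop :=
  forall f g, rational_off (supp1 u `|` supp1 w) f ->
    rational_off (supp2 u `|` supp2 w) g ->
    bracket w (fun z => L z * f z) g = bracket u f g.

Definition geronimus2 (L : C -> C) (u w : bifunctional) : Prop :=
  forall f g, rational_off (supp1 u `|` supp1 w) f ->
    rational_off (supp2 u `|` supp2 w) g ->
    bracket w f (fun z => L z * g z) = bracket u f g.

Definition Omega12 (u w : bifunctional) := lmul (S2_of w) (linv (S2_of u)).
Definition Omega21 (u w : bifunctional) := lmul (S1_of w) (linv (S1_of u)).

(* Rows l, ..., l + 2 nu - 1 and columns l - 2 nu, ..., l - 1, for
   l >= 2 nu. *)
Definition corner (A : nat -> nat -> C) (nu l : nat) : 'M[C]_(2 * nu) :=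
  \matrix_(i, j) A (l + i)%N (l - 2 * nu + j)%N.

Definition H_block (w : bifunctional) (nu l : nat) : 'M[C]_(2 * nu) :=
  diag_mx (\row_i H_of w (l + i)%N).

End BivariateFunctionals.

(* Main.v *)
Require Import Defs.
From HB Require Import structures.
From mathcomp Require Import all_boot all_order all_algebra.
From mathcomp Require Import all_classical all_reals all_analysis.
From mathcomp Require Import zify ring.

Set Implicit Arguments.
Unset Strict Implicit.
Unset Printing Implicit Defensive.

Import Order.TTheory GRing.Theory Num.Theory.
Import numFieldNormedType.Exports.
Local Open Scope classical_set_scope.
Local Open Scope sesquilinear_scope.
Local Open Scope ring_scope.

(** The Christoffel-Darboux kernels are compared through one purely algebraic
    fact on semi-infinite matrices.  Let [G] and [G'] have Gauss-Borel factors
    [S1, H, S2] and [S1', H', S2'], and suppose [G = Lam G'], where row [i] of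
    [Lam] vanishes beyond column [i + w].  With [Om = S2' S2^-1], the two
    factorizations give
      [S1 Lam S1'^-1 = H Om^dagger H'^-1].
    The left side vanishes beyond the [w]-th superdiagonal and the right side
    below the diagonal, so only a band of width [w] remains
    ([Omega_band]).  When [Lam] represents multiplication by a scalar [lam] on
    a sequence [x], this reads
      [lam (S1 x)_k = sum_j H_k conj(Om_jk) / H'_j (S1' x)_j]
    ([connection]), while [S2' y = Om (S2 y)] by definition.  Substituting the
    first formula in [lam K] and the second one in [K'] turns both kernels into
    sums of the same terms [t_jk], over [k < l, j < l + w] and [k < l, j < l]
    respectively.  The difference is the sum over [l <= j < l + w], and the band
    condition leaves the columns [l - w <= k < l]: this is the corner block of
    [Om] ([kernel_connection]).

    For functionals, [x] and [y] are the CMV sequence at two points, and [Lam]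
    is the matrix of multiplication by the Laurent polynomial in the CMV basis,
    with [w = 2 max(n, m)] ([laurent_chi]).  The relation [G = Lam G'] is the
    Geronimus condition tested on CMV monomials ([gram_geronimus1]); for a
    transformation in the second variable, the same relation holds for the
    adjoint Gram matrices ([gram_geronimus2]), whose Gauss-Borel factors are
    obtained by exchanging [S1] with [S2] and conjugating [H]
    ([gauss_borel_adj]).  The second identity is therefore the complex conjugate
    of the first one for the adjoint data.  The factors of a quasidefinite
    functional exist by Gaussian elimination ([gauss_borel_exists]). *)

(** * Truncations and inverses of lower triangular matrices *)

Lemma sum_ord_extend (V : nmodType) p N (F : nat -> V) : (p <= N)%N ->
  (forall k, (p <= k)%N -> F k = 0) -> \sum_(k < p) F k = \sum_(k < N) F k.
Proof.
move=> pN F0; rewrite (big_ord_widen N F pN) [RHS](bigID (fun k : 'I_N => (k < p)%N)) /=.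
rewrite [X in _ = _ + X]big1 ?addr0 // => k; rewrite -leqNgt; exact: F0.
Qed.

Section SemiInfinite.
Variable C : numClosedFieldType.
Implicit Types (A B G S : nat -> nat -> C) (H x y : nat -> C).

Definition lower_triangular A := forall i j, (i < j)%N -> A i j = 0.

Lemma trunc_lmul A B N : lower_triangular A ->
  trunc N (lmul A B) = trunc N A *m trunc N B.
Proof.
move=> tA; apply/matrixP => i j; rewrite !mxE.
under [RHS]eq_bigr do rewrite !mxE.
by apply: (@sum_ord_extend _ _ _ (fun k => A i k * B k j)) => // k ik; rewrite tA ?mul0r.
Qed.

Lemma trunc_unitmx S N : lower_unitriangular S -> trunc N S \in unitmx.
Proof.
move=> [S1 S0]; rewrite unitmxE det_trig.
  by rewrite big1 ?unitr1 // => i _; rewrite mxE.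
by apply/is_trig_mxP => i j ij; rewrite mxE S0.
Qed.

(** The definition of [linv] inverts a truncation whose size depends on the
    entry; a leading block of the inverse of a lower triangular matrix is the
    inverse of the leading block, so every size gives the same entries. *)
Lemma trunc_linv S N : lower_unitriangular S ->
  trunc N (linv S) = invmx (trunc N S).
Proof.
move=> uS; have [_ S0] := uS; apply/matrixP => i j; rewrite mxE /linv.
set M := maxn i j; have MN : (M.+1 <= N)%N by rewrite gtn_max !ltn_ord.
pose wid := widen_ord MN.
pose Y : 'M[C]_M.+1 := \matrix_(a, b) invmx (trunc N S) (wid a) (wid b).
suff -> : invmx (trunc M.+1 S) = Y.
  by rewrite mxE; congr (invmx _ _ _); apply/val_inj;
    rewrite /= inordK // ltnS ?leq_maxl ?leq_maxr.
(* In rows up to M, S vanishes in the columns beyond M, so the product of the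
   leading blocks is a leading block of the product. *)
have SY : trunc M.+1 S *m Y = 1%:M.
  apply/matrixP => a b; have := mulmxV (trunc_unitmx N uS).
  move/matrixP/(_ (wid a) (wid b)); rewrite !mxE => e.
  rewrite -[RHS]/((wid a == wid b)%:R) -[RHS]e.
  under eq_bigr do rewrite !mxE.
  under [RHS]eq_bigr do rewrite !mxE.
  rewrite [RHS](bigID (fun k : 'I_N => (k < M.+1)%N)) /=.
  rewrite [X in _ = _ + X]big1 ?addr0 ?big_ord_narrow //.
  move=> k; rewrite -leqNgt => Mk.
  by rewrite S0 ?mul0r // (leq_trans (ltn_ord a)).
by rewrite -[Y](mulKmx (trunc_unitmx M.+1 uS)) SY mulmx1.
Qed.

Lemma linv_lower S : lower_unitriangular S -> lower_triangular (linv S).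
Proof.
move=> uS i j; have [S1 S0] := uS; elim/ltn_ind: i => i IH ij.
have iN : (i < j.+1)%N by rewrite ltnS ltnW.
have := mulmxV (trunc_unitmx j.+1 uS); rewrite -trunc_linv //.
move/matrixP/(_ (Ordinal iN) ord_max); rewrite !mxE.
rewrite (negbTE (_ : Ordinal iN != ord_max)); last by rewrite -val_eqE /= neq_ltn ij.
rewrite (bigD1 (Ordinal iN)) //= !mxE S1 mul1r big1 ?addr0 // => k.
rewrite -val_eqE /= neq_ltn !mxE => /orP[ki|ik]; last by rewrite S0 ?mul0r.
by rewrite IH ?mulr0 // (ltn_trans ki).
Qed.

(** * Gauss-Borel factorizations *)

Definition adj G i j := (G j i)^*.

Lemma trunc_adj G N : trunc N (adj G) = (trunc N G)^t*.
Proof. by apply/matrixP => i j; rewrite !mxE. Qed.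

Definition Hdiag H N : 'M[C]_N := diag_mx (\row_i H i).

Lemma factor_entry S1 H S2 N (i j : 'I_N) :
  lower_unitriangular S1 -> lower_unitriangular S2 ->
  \sum_(k < (minn i j).+1) linv S1 i k * H k * (linv S2 j k)^* =
  (trunc N (linv S1) *m Hdiag H N *m (trunc N (linv S2))^t*) i j.
Proof.
move=> u1 u2; rewrite mul_mx_diag mxE.
under [RHS]eq_bigr do rewrite !mxE.
apply: (@sum_ord_extend _ _ _ (fun k => linv S1 i k * H k * (linv S2 j k)^*)).
  by rewrite gtn_min ltn_ord.
move=> k; rewrite gtn_min => /orP[ik|jk].
  by rewrite (linv_lower u1 ik) !mul0r.
by rewrite (linv_lower u2 jk) conjC0 mulr0.
Qed.

Lemma adjmx_unit S N : lower_unitriangular S -> (trunc N S)^t* \in unitmx.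
Proof. by move=> uS; rewrite map_unitmx unitmx_tr trunc_unitmx. Qed.

Lemma trunc_linv_adj S N : lower_unitriangular S ->
  (trunc N (linv S))^t* = invmx ((trunc N S)^t*).
Proof. by move=> uS; rewrite trunc_linv // trmx_inv map_invmx. Qed.

(** The factorization in the form in which it is used: an identity between
    finite matrices, valid for all truncations because the left factor is lower
    triangular and the right factor is upper triangular. *)
Lemma gauss_borel_trunc G S1 H S2 N : gauss_borel G S1 H S2 ->
  trunc N S1 *m trunc N G *m (trunc N S2)^t* = Hdiag H N.
Proof.
move=> [u1 u2 _ eG].
have -> : trunc N G = trunc N (linv S1) *m Hdiag H N *m (trunc N (linv S2))^t*.
  by apply/matrixP => i j; rewrite -factor_entry // mxE eG.
rewrite trunc_linv_adj // trunc_linv // !mulmxA mulmxV ?trunc_unitmx // mul1mx.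
by rewrite mulmxKV // adjmx_unit.
Qed.

Lemma gauss_borel_of_trunc G S1 H S2 :
  lower_unitriangular S1 -> lower_unitriangular S2 -> (forall k, H k != 0) ->
  (forall N, trunc N S1 *m trunc N G *m (trunc N S2)^t* = Hdiag H N) ->
  gauss_borel G S1 H S2.
Proof.
move=> u1 u2 H0 e; split=> // i j; set N := (maxn i j).+1.
have iN : (i < N)%N by rewrite ltnS leq_maxl.
have jN : (j < N)%N by rewrite ltnS leq_maxr.
rewrite (@factor_entry S1 H S2 N (Ordinal iN) (Ordinal jN)) // -e.
rewrite trunc_linv_adj // trunc_linv // mulmxA mulmxK ?adjmx_unit //.
by rewrite mulKmx ?trunc_unitmx // mxE.
Qed.

Lemma gauss_borel_adj G S1 H S2 : gauss_borel G S1 H S2 ->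
  gauss_borel (adj G) S2 (fun k => (H k)^*) S1.
Proof.
move=> [u1 u2 H0 e]; split=> // [k|i j]; first by rewrite conjC_eq0.
rewrite /adj e rmorph_sum minnC; apply: eq_bigr => k _ /=.
by rewrite !rmorphM /= conjCK; ring.
Qed.

(** Row [i] of [S] solves the linear system of the leading minor of size [i],
    which makes it orthogonal to the first [i] columns of [G]. *)
Lemma exists_row_elimination G : (forall N, \det (trunc N G) != 0) ->
  exists2 S, lower_unitriangular S &
    forall i k, (k < i)%N -> \sum_(j < i.+1) S i j * G j k = 0.
Proof.
move=> dG.
have /choice[S hS] : forall i, exists r : nat -> C, [/\ r i = 1,
    forall j, (i < j)%N -> r j = 0 &
    forall k, (k < i)%N -> \sum_(j < i.+1) r j * G j k = 0].
  move=> i.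
  have uG : trunc i G \in unitmx by rewrite unitmxE unitfE.
  pose r : 'rV_i := - (\row_k G i k) *m invmx (trunc i G).
  (* The default value supplies the diagonal 1 and the zeros beyond it. *)
  exists (fun j => if insub j is Some o then r 0 (o : 'I_i) else (j == i)%:R).
  split=> [|j ij|k ki]; first by rewrite insubN ?ltnn // eqxx.
    by rewrite insubN ?(gtn_eqF ij) // -leqNgt ltnW.
  rewrite big_ord_recr /= insubN ?ltnn // eqxx mul1r.
  have /matrixP/(_ 0 (Ordinal ki)) := mulmxKV uG (- (\row_k G i k)).
  rewrite -/r !mxE /= => e.
  apply/eqP; rewrite addr_eq0; apply/eqP.
  rewrite -[RHS]e; apply: eq_bigr => j _.
  by rewrite [trunc _ _ _ _]mxE /= (valK j : insub (j : nat) = Some j).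
exists S; first by split=> i; have [] := hS i.
by move=> i; have [] := hS i.
Qed.

(** Eliminating the rows of [G] makes [S1 G S2^dagger] upper triangular, and
    eliminating those of the adjoint makes it lower triangular, hence it is
    diagonal; its leading minors are those of [G], so the diagonal entries do
    not vanish. *)
Lemma gauss_borel_exists G : (forall N, \det (trunc N G) != 0) ->
  exists S1 H S2, gauss_borel G S1 H S2.
Proof.
move=> dG; have [S1 u1 e1] := exists_row_elimination dG.
have [|S2 u2 e2] := @exists_row_elimination (adj G).
  by move=> N; rewrite trunc_adj det_map_mx det_tr conjC_eq0.
have lower_mulmx A S N (i j : 'I_N) : lower_unitriangular S ->
    (trunc N S *m trunc N A) i j = \sum_(k < i.+1) S i k * A k j.
  move=> [_ S0]; rewrite mxE; under eq_bigr do rewrite !mxE.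
  by symmetry; apply: (@sum_ord_extend _ _ _ (fun k => S i k * A k j)) => // k ik;
    rewrite S0 ?mul0r.
pose H i := \sum_(j < i.+1) S1 i j * G j i.
have D N : trunc N S1 *m trunc N G *m (trunc N S2)^t* = Hdiag H N.
  apply/matrixP => i j; rewrite [RHS]mxE.
  have [ij|ji|/val_inj <-] := ltngtP i j.
  - rewrite -val_eqE (ltn_eqF ij) mulr0n -mulmxA.
    have -> : trunc N G *m (trunc N S2)^t* = (trunc N S2 *m trunc N (adj G))^t*.
      apply/matrixP => a b; rewrite !mxE rmorph_sum; apply: eq_bigr => k _.
      by rewrite !mxE rmorphM /= conjCK mulrC.
    rewrite mxE big1 // => k _; rewrite 3!mxE lower_mulmx //.
    have [ik|ki] := ltnP i k; first by rewrite (proj2 u1) ?mul0r // mxE.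
    by rewrite e2 ?conjC0 ?mulr0 // (leq_ltn_trans ki).
  - rewrite -val_eqE (gtn_eqF ji) mulr0n.
    rewrite mxE big1 // => k _; rewrite lower_mulmx // !mxE.
    have [jk|kj] := ltnP j k; first by rewrite (proj2 u2) ?conjC0 ?mulr0.
    by rewrite e1 ?mul0r // (leq_ltn_trans kj).
  - rewrite eqxx mulr1n !mxE (bigD1 i) //= big1 ?addr0.
      by rewrite lower_mulmx // !mxE (proj1 u2) conjC1 mulr1.
    move=> k; rewrite -val_eqE /= neq_ltn lower_mulmx // !mxE => /orP[ki|ik].
      by rewrite e1 ?mul0r.
    by rewrite (proj2 u2) ?conjC0 ?mulr0.
exists S1, H, S2; apply: gauss_borel_of_trunc => // k.
have /(congr1 determinant) := D k.+1.
rewrite det_diag !det_mulmx => e.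
have : \prod_(i < k.+1) (\row_(i < k.+1) H i) 0 i != 0.
  by rewrite -e !mulf_neq0 // -unitfE -unitmxE ?trunc_unitmx ?adjmx_unit.
by move/prodf_neq0 => /(_ ord_max isT); rewrite mxE.
Qed.

(** * Kernels of two Gram matrices related by a banded matrix *)

Definition lmulv S x k := \sum_(j < k.+1) S k j * x j.

Lemma lmulv_ord S x N (k : 'I_N) : lower_unitriangular S ->
  lmulv S x k = \sum_(j < N) S k j * x j.
Proof.
move=> [_ S0]; apply: (@sum_ord_extend _ _ _ (fun j => S k j * x j)) => // j kj.
by rewrite S0 ?mul0r.
Qed.

Lemma lmulv_trunc S x N : lower_unitriangular S ->
  \col_(k < N) lmulv S x k = trunc N S *m \col_k x k.
Proof.
move=> uS; apply/matrixP => k j; rewrite !mxE lmulv_ord //.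
by apply: eq_bigr => a _; rewrite !mxE.
Qed.

(** [S' y = (S' S^-1) (S y)]; columns beyond [j] of the transition matrix vanish,
    which leaves the number [N > j] of terms free. *)
Lemma lmulv_change S S' y N (j : 'I_N) :
  lower_unitriangular S -> lower_unitriangular S' ->
  lmulv S' y j = \sum_(k < N) lmul S' (linv S) j k * lmulv S y k.
Proof.
move=> uS uS'.
have /matrixP/(_ j 0) :
    \col_k lmulv S' y k = trunc N (lmul S' (linv S)) *m \col_k lmulv S y k.
  rewrite !lmulv_trunc // trunc_lmul ?trunc_linv; [|by []|by case: uS'].
  by rewrite mulmxA mulmxKV // trunc_unitmx.
by rewrite !mxE => ->; apply: eq_bigr => k _; rewrite !mxE.
Qed.

Section Connection.
Variables (G S1 S2 G' S1' S2' Lam : nat -> nat -> C) (H H' : nat -> C) (w : nat).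
Hypothesis gb : gauss_borel G S1 H S2.
Hypothesis gb' : gauss_borel G' S1' H' S2'.
Hypothesis band : forall i b, (i + w < b)%N -> Lam i b = 0.
Hypothesis GLam : forall i j, G i j = \sum_(b < (i + w).+1) Lam i b * G' b j.

Let Om := lmul S2' (linv S2).
Let S1Lam k b := \sum_(a < k.+1) S1 k a * Lam a b.

Lemma S1Lam_band k b : (k + w < b)%N -> S1Lam k b = 0.
Proof.
move=> kb; rewrite /S1Lam big1 // => a _; rewrite band ?mulr0 //.
by rewrite (leq_ltn_trans _ kb) // leq_add2r -ltnS.
Qed.

(** Entry [(k, j)] of [S1 Lam G' = S1 G]; by the band condition, truncating at
    [N > k + w] loses nothing. *)
Lemma S1Lam_gram k j N : (k + w < N)%N ->
  \sum_(b < N) S1Lam k b * G' b j = \sum_(a < k.+1) S1 k a * G a j.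
Proof.
move=> kN; under eq_bigr do rewrite /S1Lam mulr_suml.
rewrite exchange_big /=; apply: eq_bigr => a _.
under eq_bigr do rewrite -mulrA.
rewrite -mulr_sumr GLam; congr (_ * _); symmetry.
apply: (@sum_ord_extend _ _ _ (fun b => Lam a b * G' b j)).
  by rewrite (leq_trans _ kN) // ltnS leq_add2r -ltnS.
by move=> b ab; rewrite band ?mul0r.
Qed.

(** Row [k] of [S1 Lam S1'^-1 = H Om^dagger H'^-1]: multiply
    [(S1 Lam) G' = S1 G] by [S2'^dagger] on the right, and replace
    [G' S2'^dagger] by [S1'^-1 H'] and [S1 G] by [H S2^-dagger]. *)
Lemma S1Lam_connection k N : (k + w < N)%N ->
  (\row_(b < N) S1Lam k b) *m trunc N (linv S1') =
  \row_(j < N) (H k * (Om j k)^* / H' j).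
Proof.
move=> kN; have [u1 u2 _ _] := gb; have [u1' u2' H0' _] := gb'.
have kN' : (k < N)%N by rewrite (leq_ltn_trans _ kN) // leq_addr.
set r := \row_b _; pose o := Ordinal kN'.
have rG : r *m trunc N G' = row o (trunc N S1 *m trunc N G).
  apply/matrixP => a j; rewrite !mxE.
  under eq_bigr do rewrite !mxE.
  rewrite S1Lam_gram //; under [RHS]eq_bigr do rewrite !mxE.
  apply: (@sum_ord_extend _ _ _ (fun a => S1 k a * G a j)) => // b kb.
  by rewrite (proj2 u1) ?mul0r.
have SG : trunc N S1 *m trunc N G = Hdiag H N *m invmx ((trunc N S2)^t*).
  by rewrite -(gauss_borel_trunc N gb) mulmxK ?adjmx_unit.
have G'S : trunc N G' *m (trunc N S2')^t* = invmx (trunc N S1') *m Hdiag H' N.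
  by rewrite -(gauss_borel_trunc N gb') !mulmxA mulVmx ?trunc_unitmx // mul1mx.
have OmT : invmx ((trunc N S2)^t*) *m (trunc N S2')^t* = (trunc N Om)^t*.
  rewrite -trunc_linv_adj // -map_mxM -trmx_mul -trunc_lmul //.
  by case: u2'.
have : r *m trunc N (linv S1') *m Hdiag H' N = row o (Hdiag H N *m (trunc N Om)^t*).
  by rewrite trunc_linv // -mulmxA -G'S mulmxA rG SG -row_mul -mulmxA OmT.
move/matrixP => e; apply/matrixP => a j; move/(_ a j): e.
rewrite mul_mx_diag mxE [X in _ * X]mxE => e; rewrite ord1 [RHS]mxE.
apply: (mulIf (H0' j)); rewrite divfK //.
by rewrite -[in LHS](ord1 a) e mul_diag_mx !mxE.
Qed.

(** Besides being lower triangular, [Om] has only [w] subdiagonals, because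
    [S1 Lam S1'^-1] has only [w] superdiagonals. *)
Lemma Omega_band j k : (k + w < j)%N -> Om j k = 0.
Proof.
move=> kj; have kN : (k + w < j.+1)%N by rewrite ltnS ltnW.
have [_ _ H0 _] := gb; have [u1' _ H0' _] := gb'.
have /matrixP/(_ 0 ord_max) := S1Lam_connection kN; rewrite !mxE big1 => [/esym/eqP|b _].
  by rewrite !mulf_eq0 invr_eq0 conjC_eq0 (negbTE (H0 k)) (negbTE (H0' j)) orbF /= => /eqP.
rewrite !mxE /=; have [kb|bk] := ltnP (k + w) b; first by rewrite S1Lam_band ?mul0r.
by rewrite (linv_lower u1') ?mulr0 // (leq_ltn_trans bk).
Qed.

Variables (x y : nat -> C) (lam : C).
Hypothesis xLam : forall i, lam * x i = \sum_(b < (i + w).+1) Lam i b * x b.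

(** Since [Lam x = lam x], the left side is [(S1 Lam) x]; it is expressed through
    [S1' x] by [S1Lam_connection]. *)
Lemma connection k N : (k + w < N)%N ->
  lam * lmulv S1 x k = \sum_(j < N) (H k * (Om j k)^* / H' j) * lmulv S1' x j.
Proof.
move=> kN; have [u1' _ _ _] := gb'.
have -> : lam * lmulv S1 x k = \sum_(b < N) S1Lam k b * x b.
  rewrite /lmulv mulr_sumr; under [RHS]eq_bigr do rewrite /S1Lam mulr_suml.
  rewrite exchange_big /=; apply: eq_bigr => a _.
  rewrite mulrCA xLam; under [RHS]eq_bigr do rewrite -mulrA.
  rewrite -[RHS]mulr_sumr; congr (_ * _).
  apply: (@sum_ord_extend _ _ _ (fun b => Lam a b * x b)).
    by rewrite (leq_trans _ kN) // ltnS leq_add2r -ltnS.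
  by move=> b ab; rewrite band ?mul0r.
have /matrixP/(_ 0 0) : (\row_(b < N) S1Lam k b) *m (\col_b x b) =
    (\row_(j < N) (H k * (Om j k)^* / H' j)) *m \col_j lmulv S1' x j.
  by rewrite lmulv_trunc // -S1Lam_connection // trunc_linv // !mulmxA mulmxKV ?trunc_unitmx.
rewrite !mxE; under eq_bigr do rewrite !mxE.
by move=> ->; apply: eq_bigr => j _; rewrite !mxE.
Qed.

(** Both kernels are sums of the same terms over different index ranges, and
    the band condition cuts their difference down to a square corner. *)
Lemma kernel_connection l : (w <= l)%N ->
  \sum_(k < l) (lmulv S2' y k)^* * (H' k)^-1 * lmulv S1' x k
  - lam * (\sum_(k < l) (lmulv S2 y k)^* * (H k)^-1 * lmulv S1 x k)
  = - \sum_(i < w) \sum_(j < w) lmulv S1' x (l + i)%N * (H' (l + i)%N)^-1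
        * (Om (l + i)%N (l - w + j)%N)^* * (lmulv S2 y (l - w + j)%N)^*.
Proof.
move=> wl; have [u1 u2 H0 _] := gb; have [u1' u2' H0' _] := gb'.
pose t j k := lmulv S1' x j * (H' j)^-1 * (Om j k)^* * (lmulv S2 y k)^*.
have -> : \sum_(k < l) (lmulv S2' y k)^* * (H' k)^-1 * lmulv S1' x k =
    \sum_(j < l) \sum_(k < l) t j k.
  apply: eq_bigr => j _; rewrite (@lmulv_change S2 S2' y l j) // rmorph_sum.
  rewrite !mulr_suml; apply: eq_bigr => k _.
  by rewrite rmorphM /= /t /Om; ring.
have -> : lam * (\sum_(k < l) (lmulv S2 y k)^* * (H k)^-1 * lmulv S1 x k) =
    \sum_(j < l + w) \sum_(k < l) t j k.
  rewrite exchange_big mulr_sumr; apply: eq_bigr => k _.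
  rewrite mulrCA (@connection k (l + w)) ?ltn_add2r // mulr_sumr.
  by apply: eq_bigr => j _; rewrite /t; field; rewrite H0 H0'.
(* For j >= l, the terms with k < l - w vanish by the band condition. *)
rewrite big_split_ord /= opprD addrA subrr add0r; congr (- _).
apply: eq_bigr => i _; rewrite -(big_mkord xpredT (t (l + i)%N)).
rewrite (@big_cat_nat _ _ _ (l - w)) ?leq_subr //= big_nat big1 ?add0r; last first.
  move=> k /andP[_ kl]; rewrite /t Omega_band ?conjC0 ?mulr0 ?mul0r //.
  by rewrite ltn_addr // addnC -ltn_subRL.
rewrite -{1}[(l - w)%N]add0n big_addn subKn // big_mkord.
by apply: eq_bigr => j _; rewrite /t [(j + _)%N]addnC.
Qed.
End Connection.
End SemiInfinite.

(** * Multiplication by a Laurent polynomial in the CMV basis *)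

Section CMV.
Variable C : numClosedFieldType.

Definition chi_expo (k : nat) : int := if odd k then - (uphalf k)%:Z else (k./2)%:Z.
(** The inverse of [chi_expo]: the position of a monomial in the CMV sequence. *)
Definition chi_index (e : int) : nat :=
  match e with Posz p => p.*2 | Negz p => p.*2.+1 end.

Lemma chiE k (z : C) : chi k z = z ^ chi_expo k.
Proof. by rewrite /chi /chi_expo; case: ifP => // _; rewrite exprnN. Qed.

Lemma chi_indexK e : chi_expo (chi_index e) = e.
Proof.
by case: e => p; rewrite /chi_index /chi_expo /= ?odd_double ?doubleK ?uphalf_double.
Qed.

(** A shift of the exponent by at most [w] moves the position by at most [2 w],
    since the exponents of either sign occupy every other position. *)
Lemma chi_index_shift (d : int) w k : (`|d| <= w)%N ->
  (chi_index (d + chi_expo k)%R <= k + 2 * w)%N.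
Proof.
move=> dw; rewrite /chi_expo; have := odd_double_half k; have := uphalf_half k.
by case: (odd k); case E: (d + _) => [p|p] /=; lia.
Qed.

Definition shift_coef n m (L : int -> C) i k :=
  \sum_(j < (n + m).+1 | chi_index (j%:Z - m%:Z + chi_expo i) == k) L (j%:Z - m%:Z).

Lemma shift_coef_band n m L i k : (i + 2 * maxn n m < k)%N -> shift_coef n m L i k = 0.
Proof.
move=> ik; rewrite /shift_coef big1 // => j /eqP e; move: ik.
rewrite -e ltnNge chi_index_shift //.
have := ltn_ord j; lia.
Qed.

Lemma laurent_chi n m L i z : z != 0 ->
  laurent n m L z * chi i z =
  \sum_(k < (i + 2 * maxn n m).+1) shift_coef n m L i k * chi k z.
Proof.
move=> z0; rewrite /laurent mulr_suml.
under [RHS]eq_bigr do rewrite mulr_suml.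
rewrite (exchange_big_dep xpredT) //=; apply: eq_bigr => j _.
have b : (chi_index (j%:Z - m%:Z + chi_expo i)%R < (i + 2 * maxn n m).+1)%N.
  by rewrite ltnS chi_index_shift //; have := ltn_ord j; lia.
rewrite (big_pred1 (Ordinal b)); last by move=> k; rewrite eq_sym.
by rewrite /= [in RHS]chiE chi_indexK chiE -mulrA -expfzDr.
Qed.

End CMV.

(** * Gram matrices of functionals *)

Section Bracket.
Variable C : numClosedFieldType.
Variable v : bifunctional C.

Lemma rational_off_chi (D : set C) k : rational_off D (chi k : C -> C).
Proof.
rewrite /chi; case: (boolP (odd k)) => ok.
  exists 1, 'X^(uphalf k); split=> [|z z0 _|z z0].
  - by rewrite monic_neq0 ?monicXn.
  - by rewrite hornerXn expf_neq0.
  - by rewrite hornerXn hornerC mul1r.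
exists 'X^(k./2), 1; split=> [|z z0 _|z z0].
- by rewrite oner_neq0.
- by rewrite hornerC oner_neq0.
- by rewrite hornerXn hornerC divr1.
Qed.

(** A test function is determined by its values off the coordinate axes, so any
    representative of the tensor product computes the bracket. *)
Lemma bracketE f g t : is_tensor f g (tf_ev (b:=v) t) -> bracket v f g = pairing v t.
Proof.
move=> ft; rewrite /bracket; congr (pairing v _); apply: xget_unique => // s fs.
by apply: (tf_ev_inj (b:=v)) => -[z1 z2] [/= h1 h2]; rewrite ft ?fs.
Qed.

Lemma tf_ev_sum N (c : nat -> C) (t : nat -> testfun v) p : Cstar2 p ->
  tf_ev (\sum_(k < N) c k *: t k) p = \sum_(k < N) c k * tf_ev (t k) p.
Proof.
move=> hp; elim/big_rec2: _ => [|k a b _ <-]; last by rewrite tf_ev_linear.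
have := tf_ev_linear (b:=v) (-1) 0 0 hp.
by rewrite scaler0 addr0 mulN1r addNr.
Qed.

Lemma pairing_sum N (c : nat -> C) (t : nat -> testfun v) :
  pairing v (\sum_(k < N) c k *: t k) = \sum_(k < N) c k * pairing v (t k).
Proof. by rewrite linear_sum; apply: eq_bigr => k _; rewrite linearZ. Qed.

Lemma chi_tensor k l : exists t, is_tensor (chi k) (chi l) (tf_ev (b:=v) t).
Proof. by apply: tf_tensor; apply: rational_off_chi. Qed.

(** The test functions of the tensor products of monomials combine into one for
    the expansion of [f]; this is how the bracket of [L chi_k] is computed. *)
Lemma bracket_suml f N (c : nat -> C) l :
  (forall z, z != 0 -> f z = \sum_(k < N) c k * chi k z) ->
  bracket v f (chi l) = \sum_(k < N) c k * gram v k l.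
Proof.
move=> fE; have /choice[t ht] := chi_tensor^~ l.
rewrite (@bracketE _ _ (\sum_(k < N) c k *: t k)).
  by rewrite pairing_sum; apply: eq_bigr => k _; rewrite /gram (bracketE (ht k)).
move=> z1 z2 h1 h2; rewrite tf_ev_sum // fE // mulr_suml.
by apply: eq_bigr => k _; rewrite ht // mulrA.
Qed.

Lemma bracket_sumr f N (c : nat -> C) k :
  (forall z, z != 0 -> f z = \sum_(l < N) c l * chi l z) ->
  bracket v (chi k) f = \sum_(l < N) (c l)^* * gram v k l.
Proof.
move=> fE; have /choice[t ht] := chi_tensor k.
rewrite (@bracketE _ _ (\sum_(l < N) (c l)^* *: t l)).
  by rewrite (pairing_sum _ (fun l => (c l)^*)); apply: eq_bigr => l _;
    rewrite /gram (bracketE (ht l)).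
move=> z1 z2 h1 h2; rewrite (tf_ev_sum _ (fun l => (c l)^*)) // fE // rmorph_sum mulr_sumr.
by apply: eq_bigr => l _; rewrite ht // rmorphM mulrCA.
Qed.

Lemma gb_factorsP : quasidefinite v ->
  gauss_borel (gram v) (S1_of v) (H_of v) (S2_of v).
Proof.
move=> /gauss_borel_exists[S1 [H [S2 gb]]].
rewrite /S1_of /H_of /S2_of /gb_factors.
exact: (@xgetPex _ _ [set T | gauss_borel (gram v) T.1.1 T.1.2 T.2] (ex_intro _ (S1, H, S2) gb)).
Qed.
End Bracket.

Lemma gram_geronimus1 (C : numClosedFieldType) n m L (u v : bifunctional C) i j :
  geronimus1 (laurent n m L) u v ->
  gram u i j =
  \sum_(b < (i + 2 * maxn n m).+1) shift_coef n m L i b * gram v b j.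
Proof.
move=> h; rewrite /gram -h; [|exact: rational_off_chi..].
by apply: bracket_suml => z; apply: laurent_chi.
Qed.

Lemma gram_geronimus2 (C : numClosedFieldType) n m L (u v : bifunctional C) i j :
  geronimus2 (laurent n m L) u v ->
  adj (gram u) i j =
  \sum_(b < (i + 2 * maxn n m).+1) shift_coef n m L i b * adj (gram v) b j.
Proof.
move=> h; rewrite /adj {1}/gram -h; [|exact: rational_off_chi..].
rewrite (bracket_sumr _ _ (fun z => @laurent_chi C n m L i z)) rmorph_sum.
by apply: eq_bigr => b _; rewrite rmorphM /= conjCK.
Qed.

(** * Comparison of the kernels *)

Lemma mulmx_invdiag_sum (F : fieldType) (N : nat) (X Y d : nat -> F)
    (M : 'M[F]_N) : (forall i, d i != 0) ->
  ((\row_(i < N) X i) *m invmx (diag_mx (\row_(i < N) d i)) *m M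
    *m (\col_(j < N) Y j)) 0 0 =
  \sum_(i < N) \sum_(j < N) X i * (d i)^-1 * M i j * Y j.
Proof.
move=> d0.
have -> : invmx (diag_mx (\row_(i < N) d i)) = diag_mx (\row_(i < N) (d i)^-1).
  have dV : diag_mx (\row_(i < N) d i) *m diag_mx (\row_i (d i)^-1) = 1%:M.
    rewrite mulmx_diag; apply/matrixP => i j; rewrite !mxE divff //.
  have [ud _] := mulmx1_unit dV.
  by rewrite -[RHS](mulKmx ud) dV mulmx1.
rewrite mul_mx_diag -mulmxA mxE; apply: eq_bigr => i _.
rewrite !mxE mulr_sumr; apply: eq_bigr => j _.
by rewrite mxE mulrA.
Qed.

Theorem proposition19 (R : realType) (n m : nat) (L1 L2 : int -> R[i])
    (u u1 u2 : bifunctional R[i])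
    (hL1 : L1 n%:Z * L1 (- m%:Z) != 0) (hL2 : L2 n%:Z * L2 (- m%:Z) != 0)
    (hsupp1 : zeros (laurent n m L1) `&` supp1 u = set0)
    (hsupp2 : zeros (laurent n m L2) `&` supp2 u = set0)
    (hu1 : geronimus1 (laurent n m L1) u u1)
    (hu2 : geronimus2 (laurent n m L2) u u2)
    (qu : quasidefinite u) (qu1 : quasidefinite u1) (qu2 : quasidefinite u2)
    (l : nat) (hl : (2 * maxn n m <= l)%N)
    (z1 z2 : R[i]) (hz1 : z1 != 0) (hz2 : z2 != 0) :
  let nu := maxn n m in
  CD_kernel u1 l z1^* z2 - laurent n m L1 z2 * CD_kernel u l z1^* z2
    = - ((\row_(i < 2 * nu) phi1 u1 (l + i)%N z2)
         *m invmx (H_block u1 nu l)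
         *m map_mx Num.conj (corner (Omega12 u u1) nu l)
         *m (\col_(j < 2 * nu) (phi2 u (l - 2 * nu + j)%N z1)^*)) 0 0
  /\
  CD_kernel u2 l z1^* z2
      - conjfun (laurent n m L2) z1^* * CD_kernel u l z1^* z2
    = - ((\row_(i < 2 * nu) (phi2 u2 (l + i)%N z1)^*)
         *m invmx (H_block u2 nu l)
         *m corner (Omega21 u u2) nu l
         *m (\col_(j < 2 * nu) phi1 u (l - 2 * nu + j)%N z2)) 0 0.
Proof.
move=> nu; have gb := gb_factorsP qu.
have kernelE v : CD_kernel v l z1^* z2 =
    \sum_(k < l) (lmulv (S2_of v) (fun i => chi i z1) k)^* * (H_of v k)^-1 *
      lmulv (S1_of v) (fun i => chi i z2) k.
  by apply: eq_bigr => k _; rewrite /conjfun conjCK.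
split.
- have gb1 := gb_factorsP qu1; have [_ _ H0 _] := gb1.
  rewrite !kernelE (kernel_connection gb gb1 (@shift_coef_band _ n m L1) _ _
    (fun i => @laurent_chi _ n m L1 i z2 hz2) hl); last first.
    by move=> i j; apply: gram_geronimus1.
  rewrite (@mulmx_invdiag_sum _ (2 * nu) (fun i => phi1 u1 (l + i) z2)
    (fun j => (phi2 u (l - 2 * nu + j) z1)^*)
    (fun i => H_of u1 (l + i))) //.
  congr (- _); apply: eq_bigr => i _; apply: eq_bigr => j _.
  by rewrite !mxE.
- have gb2 := gb_factorsP qu2; have [_ _ H0 _] := gb2.
  (* Exchanging the roles of z1 and z2, the conjugate kernels are those of the
     adjoint factorization. *)
  have kernelC v : CD_kernel v l z1^* z2 =
      (\sum_(k < l) (lmulv (S1_of v) (fun i => chi i z2) k)^* * ((H_of v k)^*)^-1 *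
        lmulv (S2_of v) (fun i => chi i z1) k)^*.
    rewrite kernelE rmorph_sum; apply: eq_bigr => k _.
    by rewrite !rmorphM fmorphV /= !conjCK; ring.
  rewrite !kernelC /conjfun conjCK -rmorphM -rmorphB /=.
  rewrite (kernel_connection (gauss_borel_adj gb) (gauss_borel_adj gb2)
    (@shift_coef_band _ n m L2) (fun i j => gram_geronimus2 i j hu2) (fun i => chi i z2)
    (fun i => @laurent_chi _ n m L2 i z1 hz1) hl).
  rewrite (@mulmx_invdiag_sum _ (2 * nu) (fun i => (phi2 u2 (l + i) z1)^*)
    (fun j => phi1 u (l - 2 * nu + j) z2)
    (fun i => H_of u2 (l + i))) //.
  rewrite rmorphN rmorph_sum; congr (- _); apply: eq_bigr => i _.
  rewrite rmorph_sum; apply: eq_bigr => j _.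
  by rewrite !rmorphM fmorphV /= !conjCK mxE.
Qed.
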